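(* Let $\ell\ge 1$. For every arrival sequence $\mathbf{b}\in B_\ell$, the sequence of coin flips $\mathbf{c}=\phi(\mathbf{b})\in C_\ell$ satisfies $\max(\mathbf{c})=r(\mathbf{b})$; that is, the maximum of the number of heads and the number of tails in $\phi(\mathbf{b})$ equals the length of the right lane of $\mathbf{b}$.
   Context: An arrival sequence of length $\ell$ is a binary string $\mathbf{b}=b_1b_2\cdots b_\ell\in\{0,1\}^\ell$; $B_\ell$ is the set of all of them. Cars $1,2,\dots,\ell$ arrive in order and choose between two initially empty lanes (left and right): if $b_i=0$, car $i$ enters the right lane; if $b_i=1$, car $i$ enters the currently shorter lane, and enters the right lane if both lanes have the same length. $r(\mathbf{b})$ denotes the final number of cars in the right lane. Position $i$ is called a bounce of $\mathbf{b}$ if $b_i=1$ and car $i$ enters the right lane. The parity vector $\mathbf{p}(\mathbf{b})=p_1p_2\cdots p_\ell\in\{0,1\}^\ell$ is defined by $p_1=0$ and, for $1\le i\le \ell-1$, $p_{i+1}=1-p_i$ if position $i$ is a bounce of $\mathbf{b}$, and $p_{i+1}=p_i$ otherwise. $C_\ell$ is the set of sequences of $\ell$ coin flips, identified with $\{0,1\}^\ell$ via $0=$ heads, $1=$ tails. For $\mathbf{c}\in C_\ell$, $h(\mathbf{c})$ and $t(\mathbf{c})$ are the numbers of heads and tails, and $\max(\mathbf{c})=\max\{h(\mathbf{c}),t(\mathbf{c})\}$. The map $\phi:B_\ell\to C_\ell$ is $\phi(\mathbf{b})=\mathbf{b}+\mathbf{p}(\mathbf{b})$, with entrywise addition modulo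 $2$. *)

(* Defs.v *)
From mathcomp Require Import all_boot.

Set Implicit Arguments.
Unset Strict Implicit.
Unset Printing Implicit Defensive.

(* Positions are numbered from 0: position i of a sequence of length ell
   (i < ell) is the position i + 1 of the usual 1-based numbering.  In an
   arrival sequence the bit 1 is [true]; in a sequence of coin flips heads is
   0 = [false] and tails is 1 = [true]. *)

Record lanes := Lanes { left_lane : nat; right_lane : nat }.

(* Whether the next car, with arrival bit x, enters the right lane: always if
   x = 0; if x = 1, when the right lane is shorter or the lanes are tied. *)
Definition enters_right (s : lanes) (x : bool) : bool :=
  ~~ x || (right_lane s <= left_lane s).

Definition arrive (s : lanes) (x : bool) : lanes :=
  if enters_right s x then Lanes (left_lane s) (right_lane s).+1
  else Lanes (left_lane s).+1 (right_lane s).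

Definition final_lanes (s : seq bool) : lanes := foldl arrive (Lanes 0 0) s.

Section Arrivals.

Variables (ell : nat) (b : ell.-tuple bool).

Definition lanes_before (i : nat) : lanes := final_lanes (take i b).

Definition r : nat := right_lane (final_lanes b).

(* For i >= ell the default bit makes [bounce i] false; such positions are
   never used by [parity_vector]. *)
Definition bounce (i : nat) : bool :=
  let b_i := nth false b i in b_i && enters_right (lanes_before i) b_i.

Fixpoint parity (i : nat) : bool :=
  if i is j.+1 then (if bounce j then ~~ parity j else parity j) else false.

Definition parity_vector : ell.-tuple bool := [tuple parity i | i < ell].

(* [addb] is addition modulo 2 on bits. *)
Definition phi : ell.-tuple bool :=
  [tuple addb (tnth b i) (tnth parity_vector i) | i < ell].

End Arrivals.

Definition heads (ell : nat) (c : ell.-tuple bool) : nat := count_mem false c.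
Definition tails (ell : nat) (c : ell.-tuple bool) : nat := count_mem true c.
Definition max_flips (ell : nat) (c : ell.-tuple bool) : nat :=
  maxn (heads c) (tails c).

(* Main.v *)
(** After each arrival the right lane holds as many cars as there are flips
    equal to the current parity, and the left lane as many as there are flips
    equal to its negation. A bounce exchanges the roles of heads and tails, but
    it only happens when the two lanes are tied, so the correspondence
    survives. The right lane is never the shorter one, hence it realises the
    maximum. *)
Require Import Defs.
From mathcomp Require Import all_boot.

(** Total in [i], so a prefix of the flips is an [mkseq] that grows at its end. *)
Definition flip {ell : nat} (b : ell.-tuple bool) (i : nat) : bool :=
  addb (nth false b i) (parity b i).

Lemma phi_mkseq {ell : nat} (b : ell.-tuple bool) :
  phi b = mkseq (flip b) ell :> seq bool.
Proof.
apply: (@eq_from_nth _ false); first by rewrite size_tuple size_mkseq.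
move=> i; rewrite size_tuple => lt_i.
rewrite nth_mkseq // -[i]/(val (Ordinal lt_i)) -tnth_nth !tnth_mktuple.
by rewrite (tnth_nth false).
Qed.

Lemma lanes_before_succ {ell : nat} (b : ell.-tuple bool) (i : nat) :
  i < ell ->
  lanes_before b i.+1 = arrive (lanes_before b i) (nth false b i).
Proof.
move=> lt_i; rewrite /lanes_before /final_lanes.
by rewrite (take_nth false) ?size_tuple // foldl_rcons.
Qed.

Lemma lanes_flips {ell : nat} (b : ell.-tuple bool) (i : nat) : i <= ell ->
  let s := lanes_before b i in
  let c := mkseq (flip b) i in
  [/\ left_lane s <= right_lane s,
      right_lane s = count_mem (parity b i) c
    & left_lane s = count_mem (~~ parity b i) c].
Proof.
elim: i => [_|i IHi lt_i]; first by rewrite /lanes_before take0.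
have [le_lr] := IHi (ltnW lt_i).
cbv zeta; rewrite lanes_before_succ // mkseqS -cats1 !count_cat /=.
rewrite /bounce /flip /arrive /enters_right.
case: (lanes_before b i) le_lr => l r /= le_lr eq_r eq_l.
(* Bit 0: the flip equals the parity, which stays, and the right lane grows. *)
case: (nth false b i) => /=; last first.
  split=> /=; first exact: leqW.
    by rewrite eqxx -eq_r addn1.
  by case: (parity b i) eq_l => <- /=; rewrite !addn0.
case: (leqP r l) => [le_rl|lt_lr] /=.
  (* Bounce: the flip is the negated parity, which is also the new parity; the tie lets the two
     counts trade lanes. *)
  have eq_lr : l = r by apply/eqP; rewrite eqn_leq le_lr.
  split; first by rewrite eq_lr.
    by rewrite -eq_l eqxx eq_lr addn1.
  by rewrite negbK -eq_r eq_lr; case: (parity b i) => /=; rewrite !addn0.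
(* No bounce: the left lane grows, and [l < r] keeps it from overtaking. *)
split=> //; first by case: (parity b i) eq_r => <- /=; rewrite !addn0.
by rewrite -eq_l eqxx addn1.
Qed.

Theorem theorem3p6 (ell : nat) (ell_ge1 : 1 <= ell) (b : ell.-tuple bool) :
  max_flips (phi b) = r b.
Proof.
have [] := lanes_flips b ell (leqnn ell).
rewrite -phi_mkseq /lanes_before take_oversize ?size_tuple // -/(r b).
rewrite /max_flips /heads /tails => le_lr eq_r eq_l.
(* The final parity decides whether the right lane counts heads or tails. *)
case: (parity b ell) eq_r eq_l => /= <- <-; first exact/maxn_idPr.
exact/maxn_idPl.
Qed.
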